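(* Let $U\subseteq V$, where $V$ is a theory in the same language as $U$ extending $U$, and suppose $U$ is (effectively) Friedman-reflexive. Then $V$ is (effectively) Friedman-reflexive, and any function ${\sf C}$ selecting interpreters over $U$ also selects interpreters over $V$.
   Context: Theories are first-order theories in finite signature with arbitrary axiom sets; interpretations may be multi-dimensional and piecewise; $W\rhd D$ means $W$ interprets $D$. A $U$-sentence $C$ is an interpreter of finitely axiomatised $A$ over $U$ iff for all $U$-sentences $B$: $(U+B)\rhd A$ iff $U+B\vdash C$; $U$ is Friedman-reflexive iff every finitely axiomatised $A$ has an interpreter over $U$, and effectively so if interpreters can be chosen by a recursive function. *)

(* Defs.v *)
From Stdlib Require List.
From mathcomp Require Import all_boot.
From mathcomp Require Import classical_sets.

Set Implicit Arguments.
Unset Strict Implicit.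
Unset Printing Implicit Defensive.

Local Open Scope classical_set_scope.

(** * First-order logic with identity over finite signatures *)

(* A finite signature is given, up to renaming of its symbols, by the lists of
   the arities of its function symbols (constants have arity 0) and of its
   relation symbols; identity is a logical symbol. *)
Record signature := Signature { fun_arities : seq nat; rel_arities : seq nat }.

Definition fsym (S : signature) := 'I_(size (fun_arities S)).
Definition rsym (S : signature) := 'I_(size (rel_arities S)).
Definition far (S : signature) (f : fsym S) : nat := nth 0 (fun_arities S) f.
Definition rar (S : signature) (r : rsym S) : nat := nth 0 (rel_arities S) r.

(* [term S X] and [form S X] are the terms and formulas whose free variables
   are taken from the type [X]. A binder adds one variable, [None], to those in
   scope; a sentence is a formula without free variables. *)
Inductive term (S : signature) (X : Type) : Type :=
| Var (x : X)
| App (f : fsym S) (ts : 'I_(far f) -> term S X).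
Arguments Var {S X} x.

Inductive form (S : signature) (X : Type) : Type :=
| Bot
| Eq (s t : term S X)
| Rel (r : rsym S) (ts : 'I_(rar r) -> term S X)
| Imp (a b : form S X)
| All (a : form S (option X)).
Arguments Bot {S X}.

Definition sentence (S : signature) := form S void.

Definition Neg S (X : Type) (a : form S X) : form S X := Imp a Bot.
Definition Top {S} {X : Type} : form S X := Neg Bot.
Definition And S (X : Type) (a b : form S X) : form S X := Neg (Imp a (Neg b)).
Definition Or S (X : Type) (a b : form S X) : form S X := Imp (Neg a) b.
Definition Ex S (X : Type) (a : form S (option X)) : form S X :=
  Neg (All (Neg a)).

Fixpoint trename S (X Y : Type) (g : X -> Y) (t : term S X) : term S Y :=
  match t with
  | Var x => Var (g x)
  | App f ts => App (fun k => trename g (ts k))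
  end.

Fixpoint rename S (X Y : Type) (g : X -> Y) (a : form S X) : form S Y :=
  match a with
  | Bot => Bot
  | Eq s t => Eq (trename g s) (trename g t)
  | Rel r ts => Rel (fun k => trename g (ts k))
  | Imp b c => Imp (rename g b) (rename g c)
  | All b => All (rename (omap g) b)
  end.

Fixpoint tsubst S (X Y : Type) (g : X -> term S Y) (t : term S X) : term S Y :=
  match t with
  | Var x => g x
  | App f ts => App (fun k => tsubst g (ts k))
  end.

Definition up S (X Y : Type) (g : X -> term S Y) (o : option X) :
    term S (option Y) :=
  if o is Some x then trename Some (g x) else Var None.

Fixpoint subst S (X Y : Type) (g : X -> term S Y) (a : form S X) : form S Y :=
  match a with
  | Bot => Bot
  | Eq s t => Eq (tsubst g s) (tsubst g t)
  | Rel r ts => Rel (fun k => tsubst g (ts k))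
  | Imp b c => Imp (subst g b) (subst g c)
  | All b => All (subst (up g) b)
  end.

Definition inst S (X : Type) (t : term S X) (a : form S (option X)) :
    form S X :=
  subst (fun o => if o is Some x then Var x else t) a.

(** ** Provability: classical natural deduction from an arbitrary set *)

(* [prf_inh] expresses that domains are nonempty; it is needed because there
   may be no terms at all over a given type of variables. *)
Inductive prf (S : signature) :
    forall X : Type, set (form S X) -> form S X -> Prop :=
| prf_ax (X : Type) (G : set (form S X)) a : G a -> prf G a
| prf_impI (X : Type) (G : set (form S X)) a b :
    prf (G `|` [set a]) b -> prf G (Imp a b)
| prf_impE (X : Type) (G : set (form S X)) a b :
    prf G (Imp a b) -> prf G a -> prf G b
| prf_raa (X : Type) (G : set (form S X)) a :
    prf (G `|` [set Neg a]) Bot -> prf G a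
| prf_allI (X : Type) (G : set (form S X)) (a : form S (option X)) :
    prf (rename Some @` G) a -> prf G (All a)
| prf_allE (X : Type) (G : set (form S X)) (a : form S (option X)) t :
    prf G (All a) -> prf G (inst t a)
| prf_refl (X : Type) (G : set (form S X)) t : prf G (Eq t t)
| prf_leib (X : Type) (G : set (form S X)) (a : form S (option X)) s t :
    prf G (Eq s t) -> prf G (inst s a) -> prf G (inst t a)
| prf_inh (X : Type) (G : set (form S X)) :
    prf G (Ex (Eq (Var None) (Var None))).

(* Theories are given by arbitrary sets of axioms. *)
Definition theory (S : signature) := set (sentence S).

Definition extends S (V U : theory S) :=
  forall a : sentence S, prf U a -> prf V a.

Definition add_axiom S (U : theory S) (B : sentence S) : theory S :=
  U `|` [set B].

Record fin_theory := FinTheory {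
  fin_sig : signature;
  fin_axioms : seq (sentence fin_sig) }.

Definition theory_of (A : fin_theory) : theory (fin_sig A) :=
  [set a | List.In a (fin_axioms A)].
Arguments theory_of : clear implicits.

(** ** Quantification over finite blocks of variables *)

Fixpoint all_ord S (d : nat) :
    forall X : Type, form S (X + 'I_d)%type -> form S X :=
  match d with
  | 0 => fun X a =>
      rename (fun y : X + 'I_0 =>
        match y with
        | inl x => x
        | inr i => False_rect X (notF (ltn_ord i))
        end) a
  | d'.+1 => fun X a =>
      All (all_ord (rename (fun y : X + 'I_d'.+1 =>
        match y with
        | inl x => inl (Some x)
        | inr i => if unlift ord0 i is Some j then inr j else inl None
        end) a))
  end.

Definition all_block S (X : Type) (I : finType) (a : form S (X + I)%type) :
    form S X :=
  all_ord (rename (fun y : X + I =>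
    match y with inl x => inl x | inr i => inr (enum_rank i) end) a).

Definition ex_block S (X : Type) (I : finType) (a : form S (X + I)%type) :
    form S X :=
  Neg (all_block (Neg a)).

(** * Translations and interpretations *)

(* A multi-dimensional, piecewise, parameter-free translation of the language
   of [S] into that of [T]. The domain consists of [pieces] many pieces, the
   i-th of which consists of [dim i]-tuples satisfying [dom i]. The symbols of
   [S], including identity, are translated separately for every choice of the
   pieces to which the arguments belong; a function symbol is translated by a
   formula for its graph, the right summand being the block of the value. *)
Record translation (S T : signature) := Translation {
  pieces : nat;
  dim : 'I_pieces -> nat;
  dom : forall i, form T 'I_(dim i);
  eqf : forall i j, form T ('I_(dim i) + 'I_(dim j))%type;
  relf : forall (r : rsym S) (p : 'I_(rar r) -> 'I_pieces),
    form T {k : 'I_(rar r) & 'I_(dim (p k))};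
  funf : forall (f : fsym S) (p : 'I_(far f) -> 'I_pieces) (j : 'I_pieces),
    form T ({k : 'I_(far f) & 'I_(dim (p k))} + 'I_(dim j))%type }.

Section Translate.
Variables (S T : signature) (tau : translation S T).

(* What replaces a single variable of [S]: a piece, and a tuple of variables of
   the dimension of that piece. *)
Definition obj (X : Type) := {i : 'I_(pieces tau) & 'I_(dim i) -> X}.

Definition obj_map (X Y : Type) (g : X -> Y) (o : obj X) : obj Y :=
  existT _ (tag o) (g \o tagged o).

Definition dom_at (X : Type) (o : obj X) : form T X :=
  rename (tagged o) (dom (tag o)).

Definition eq_at (X : Type) (o o' : obj X) : form T X :=
  rename (fun y => match y with
    | inl k => tagged o k
    | inr k => tagged o' k
    end) (eqf (tag o) (tag o')).

Definition rel_at (X : Type) (r : rsym S) (os : 'I_(rar r) -> obj X) :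
    form T X :=
  rename (fun y => tagged (os (tag y)) (tagged y))
         (relf (fun k => tag (os k))).

Definition fun_at (X : Type) (f : fsym S) (os : 'I_(far f) -> obj X)
    (o : obj X) : form T X :=
  rename (fun y => match y with
    | inl z => tagged (os (tag z)) (tagged z)
    | inr k => tagged o k
    end) (funf (fun k => tag (os k)) (tag o)).

(* There are objects of the domain, indexed by [N], such that [body] holds of
   them. The body is a formula over an extension [X'] of the variables [X]. *)
Definition ex_objs (X : Type) (N : finType)
    (body : forall X' : Type, (X -> X') -> (N -> obj X') -> form T X') :
    form T X :=
  \big[@Or T X/Bot]_(p : {ffun N -> 'I_(pieces tau)})
    ex_block (I := {n : N & 'I_(dim (p n))})
      (let z n := existT _ (p n) (fun k => inr (existT _ n k)) in
       And (\big[@And T _/Top]_(n : N) dom_at (z n))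
           (body _ inl z)).

(* Atomic formulas are translated after unravelling their terms: one auxiliary
   object is introduced for (the value of) every occurrence of a function
   symbol, and none for the variables. *)
Fixpoint nodes (X : Type) (t : term S X) : finType :=
  match t with
  | Var _ => void
  | App f ts => option {k : 'I_(far f) & nodes (ts k)}
  end.

Definition value (X Y : Type) (rho : X -> obj Y) (t : term S X) :
    (nodes t -> obj Y) -> obj Y :=
  match t with
  | Var x => fun _ => rho x
  | App f ts => fun z => z None
  end.

Fixpoint unravel (X Y : Type) (rho : X -> obj Y) (t : term S X) :
    (nodes t -> obj Y) -> form T Y :=
  match t with
  | Var x => fun _ => Top
  | App f ts => fun z =>
      let zs k (n : nodes (ts k)) := z (Some (existT _ k n)) in
      And (\big[@And T Y/Top]_k unravel rho (zs k))
          (fun_at (fun k => value rho (zs k)) (z None))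
  end.

Fixpoint translate (X : Type) (a : form S X) :
    forall Y : Type, (X -> obj Y) -> form T Y :=
  match a with
  | Bot => fun Y rho => Bot
  | Eq s t => fun Y rho =>
      ex_objs (N := (nodes s + nodes t)%type) (fun Y' g z =>
        let rho' := obj_map g \o rho in
        And (And (unravel rho' (z \o inl)) (unravel rho' (z \o inr)))
            (eq_at (value rho' (z \o inl)) (value rho' (z \o inr))))
  | Rel r ts => fun Y rho =>
      ex_objs (N := {k : 'I_(rar r) & nodes (ts k)}) (fun Y' g z =>
        let rho' := obj_map g \o rho in
        let zs k (n : nodes (ts k)) := z (existT _ k n) in
        And (\big[@And T Y'/Top]_k unravel rho' (zs k))
            (rel_at (fun k => value rho' (zs k))))
  | Imp b c => fun Y rho => Imp (translate b rho) (translate c rho)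
  | All b => fun Y rho =>
      \big[@And T Y/Top]_(i < pieces tau)
        all_block (I := 'I_(dim i))
          (let z := existT _ i inr in
           Imp (dom_at z)
             (translate b (fun o =>
                if o is Some x then obj_map inl (rho x) else z)))
  end.

Definition translate_sentence (a : sentence S) : sentence T :=
  translate a (fun x : void => match x with end).

End Translate.

Definition interprets (T S : signature) (W : theory T) (D : theory S) :=
  exists tau : translation S T,
    forall a : sentence S, prf D a -> prf W (translate_sentence tau a).

(** * Recursive functions *)

(* Descriptions of partial recursive functions of finitely many natural
   numbers, with their graphs. *)
Inductive recdesc : Type :=
| RZero
| RSucc
| RProj (i : nat)
| RComp (f : recdesc) (gs : seq recdesc)
| RPrec (f g : recdesc)
| RMin (f : recdesc).

Inductive reval : recdesc -> seq nat -> nat -> Prop :=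
| reval_zero xs : reval RZero xs 0
| reval_succ x xs : reval RSucc (x :: xs) x.+1
| reval_proj i xs : i < size xs -> reval (RProj i) xs (nth 0 xs i)
| reval_comp f gs xs ys y :
    size ys = size gs ->
    (forall i, i < size gs -> reval (nth RZero gs i) xs (nth 0 ys i)) ->
    reval f ys y -> reval (RComp f gs) xs y
| reval_prec0 f g xs y : reval f xs y -> reval (RPrec f g) (0 :: xs) y
| reval_precS f g n xs y z :
    reval (RPrec f g) (n :: xs) y -> reval g (n :: y :: xs) z ->
    reval (RPrec f g) (n.+1 :: xs) z
| reval_min f n xs :
    (forall m, m < n -> exists y, reval f (m :: xs) y.+1) ->
    reval f (n :: xs) 0 -> reval (RMin f) xs n.

(* Goedel numbers, built with the injective coding [CodeSeq.code] of finite
   sequences of numbers. [c] gives the numbers of the free variables. *)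
Fixpoint code_term S (X : Type) (c : X -> nat) (t : term S X) : nat :=
  match t with
  | Var x => CodeSeq.code [:: 0; c x]
  | App f ts =>
      CodeSeq.code [:: 1, f : nat &
        [seq code_term c (ts k) | k <- enum 'I_(far f)]]
  end.

Fixpoint code_form S (X : Type) (c : X -> nat) (a : form S X) : nat :=
  match a with
  | Bot => CodeSeq.code [:: 0]
  | Eq s t => CodeSeq.code [:: 1; code_term c s; code_term c t]
  | Rel r ts =>
      CodeSeq.code [:: 2, r : nat &
        [seq code_term c (ts k) | k <- enum 'I_(rar r)]]
  | Imp b d => CodeSeq.code [:: 3; code_form c b; code_form c d]
  | All b =>
      CodeSeq.code [:: 4;
        code_form (fun o => if o is Some x then (c x).+1 else 0) b]
  end.

Definition code_sentence S (a : sentence S) : nat :=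
  code_form (fun x : void => match x with end) a.

Definition code_fin_theory (A : fin_theory) : nat :=
  CodeSeq.code [:: CodeSeq.code (fun_arities (fin_sig A));
                   CodeSeq.code (rel_arities (fin_sig A));
                   CodeSeq.code [seq code_sentence a | a <- fin_axioms A]].

Definition recursive S (C : fin_theory -> sentence S) :=
  exists e : recdesc, forall A : fin_theory,
    reval e [:: code_fin_theory A] (code_sentence (C A)).

(** * Friedman-reflexivity *)

Definition interpreter S (U : theory S) (A : fin_theory) (C : sentence S) :=
  forall B : sentence S,
    interprets (add_axiom U B) (theory_of A) <-> prf (add_axiom U B) C.

Definition Friedman_reflexive S (U : theory S) :=
  forall A : fin_theory, exists C : sentence S, interpreter U A C.

Definition selects_interpreters S (U : theory S)
    (C : fin_theory -> sentence S) :=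
  forall A : fin_theory, interpreter U A (C A).

Definition effectively_Friedman_reflexive S (U : theory S) :=
  exists C : fin_theory -> sentence S,
    recursive C /\ selects_interpreters U C.

(* Main.v *)
From Stdlib Require List.
From mathcomp Require Import all_boot.
From mathcomp Require Import boolp classical_sets.
Require Import Defs.

Set Implicit Arguments.
Unset Strict Implicit.
Unset Printing Implicit Defensive.

Local Open Scope classical_set_scope.

(* An interpretation of a finitely axiomatised [A] in [V + B] uses only one
   theorem [c] of [V + B]: a translation [tau] turns a model of the target
   theory into a structure whose identity need not be a congruence and whose
   functions need not be total, but that this structure is proper and satisfies
   [A] is expressed by the [tau]-translation of a single sentence. By
   compactness that translation follows from one theorem [c] of [V + B], so
   [tau] already interprets [A] in [U + c], whence [U + c |- C] and
   [V + B |- C]. Conversely, if [V + B |- C], then [c |- C] for some theorem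
   [c] of [V + B], so [U + c], and a fortiori [V + B], interprets [A].
   Provability of translated sentences is controlled semantically, by Henkin's completeness
   theorem. *)

(** * Syntax and derivability *)

Section Substitution.
Variable S : signature.

Lemma tsubst_comp X Y Z (g : X -> term S Y) (h : Y -> term S Z) t :
  tsubst h (tsubst g t) = tsubst (tsubst h \o g) t.
Proof. by elim: t => //= f ts IH; congr App; apply: funext. Qed.

Lemma trenameE X Y (g : X -> Y) (t : term S X) :
  trename g t = tsubst (Var \o g) t.
Proof. by elim: t => //= f ts IH; congr App; apply: funext. Qed.

Lemma tsubst_id X (t : term S X) : tsubst Var t = t.
Proof. by elim: t => //= f ts IH; congr App; apply: funext. Qed.

Lemma up_Var X Y (g : X -> Y) : up (S := S) (Var \o g) = Var \o omap g.
Proof. by apply: funext => -[]. Qed.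

(** Lets the laws of renaming be read off from those of [subst]. *)
Lemma renameE X Y (g : X -> Y) (a : form S X) :
  rename g a = subst (Var \o g) a.
Proof.
elim: a Y g => //= {X}.
- by move=> X s t Y g; rewrite !trenameE.
- by move=> X r ts Y g; congr Rel; apply: funext => k; rewrite trenameE.
- by move=> X a IHa b IHb Y g; rewrite IHa IHb.
- by move=> X a IH Y g; rewrite IH up_Var.
Qed.

Lemma up_comp X Y Z (g : X -> term S Y) (h : Y -> term S Z) :
  tsubst (up h) \o up g = up (tsubst h \o g).
Proof.
apply: funext => -[x|] //=; rewrite !trenameE !tsubst_comp.
by congr tsubst; apply: funext => y /=; rewrite trenameE.
Qed.

Lemma subst_comp X Y Z (g : X -> term S Y) (h : Y -> term S Z) a :
  subst h (subst g a) = subst (tsubst h \o g) a.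
Proof.
elim: a Y Z g h => //= {X}.
- by move=> X s t Y Z g h; rewrite !tsubst_comp.
- by move=> X r ts Y Z g h; congr Rel; apply: funext => k; rewrite tsubst_comp.
- by move=> X a IHa b IHb Y Z g h; rewrite IHa IHb.
- by move=> X a IH Y Z g h; rewrite IH up_comp.
Qed.

Lemma subst_id X (a : form S X) : subst Var a = a.
Proof.
elim: a => //= {X}.
- by move=> X s t; rewrite !tsubst_id.
- by move=> X r ts; congr Rel; apply: funext => k; rewrite tsubst_id.
- by move=> X a -> b ->.
- move=> X a IH; rewrite -[in RHS]IH; congr (All (subst _ _)).
  by apply: funext => -[].
Qed.

Lemma rename_comp X Y Z (g : X -> Y) (h : Y -> Z) (a : form S X) :
  rename h (rename g a) = rename (h \o g) a.
Proof. by rewrite !renameE subst_comp. Qed.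

Lemma rename_inst X Y (g : X -> Y) t (a : form S (option X)) :
  rename g (inst t a) = inst (trename g t) (rename (omap g) a).
Proof.
rewrite /inst !renameE !subst_comp; congr subst.
by apply: funext => -[x|] //=; rewrite trenameE.
Qed.

End Substitution.

(** * Structural rules and compactness of derivations *)

Section Derivability.
Variable S : signature.

Lemma prf_weaken X (G H : set (form S X)) a : prf G a -> G `<=` H -> prf H a.
Proof.
move=> p; elim: p H => {X G a}.
- by move=> X G a Ga H GH; apply/prf_ax/GH.
- by move=> X G a b _ IH H GH; apply/prf_impI/IH/setSU.
- by move=> X G a b _ IHa _ IHb H GH; apply: prf_impE (IHa _ GH) (IHb _ GH).
- by move=> X G a _ IH H GH; apply/prf_raa/IH/setSU.
- by move=> X G a _ IH H GH; apply/prf_allI/IH/image_subset.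
- by move=> X G a t _ IH H GH; apply/prf_allE/IH.
- by move=> X G t H _; apply: prf_refl.
- by move=> X G a s t _ IHe _ IH H GH; apply: prf_leib (IHe _ GH) (IH _ GH).
- by move=> X G H _; apply: prf_inh.
Qed.

(** The renaming may identify variables: with binders as nested types nothing is captured, and
    [omap g] keeps the eigenvariable [None] apart. *)
Lemma prf_rename X Y (g : X -> Y) (G : set (form S X)) a :
  prf G a -> prf (rename g @` G) (rename g a).
Proof.
move=> p; elim: p Y g => {X G a}.
- by move=> X G a Ga Y g; apply: prf_ax; exists a.
- move=> X G a b _ IH Y g; apply: prf_impI.
  by move: (IH _ g); rewrite image_setU image_set1.
- by move=> X G a b _ IHa _ IHb Y g; apply: prf_impE (IHa _ g) (IHb _ g).
- move=> X G a _ IH Y g; apply: prf_raa.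
  by move: (IH _ g); rewrite image_setU image_set1.
- move=> X G a _ IH Y g; apply: prf_allI.
  apply: prf_weaken (IH _ (omap g)) _ => _ [_ [b Gb <-] <-].
  by exists (rename g b); [exists b | rewrite !rename_comp].
- by move=> X G a t _ IH Y g; rewrite rename_inst; apply/prf_allE/IH.
- by move=> X G t Y g; apply: prf_refl.
- move=> X G a s t _ IHe _ IH Y g; rewrite rename_inst.
  by apply: prf_leib (IHe _ g) _; rewrite -rename_inst.
- by move=> X G Y g; apply: prf_inh.
Qed.

(** Serves the rules that discharge a hypothesis: the used hypotheses from [G] are kept, the
    remaining ones lie in [H]. *)
Lemma sublist_setU T (G H : set T) L : (forall x, List.In x L -> (G `|` H) x) ->
  exists2 K, (forall x, List.In x K -> G x) &
    forall x, List.In x L -> List.In x K \/ H x.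
Proof.
elim: L => [|x L IH] LGH; first by exists nil.
have [y Ly|K KG LK] := IH; first by apply: LGH; right.
have [Gx|Hx] := LGH x (or_introl erefl).
- exists (x :: K) => y /=; first by case=> [<-|/KG].
  by case=> [<-|/LK[Ky|Hy]]; [left; left | left; right | right].
- by exists K => // y /= [<-|/LK//]; right.
Qed.

Lemma sublist_image T T' (f : T -> T') (G : set T) L :
  (forall x, List.In x L -> (f @` G) x) ->
  exists2 K, (forall x, List.In x K -> G x) &
    forall x, List.In x L -> exists2 y, List.In y K & f y = x.
Proof.
elim: L => [|x L IH] LG; first by exists nil.
have [y Ly|K KG LK] := IH; first by apply: LG; right.
have [y Gy yx] := LG x (or_introl erefl).
exists (y :: K) => [z [<-|/KG]//|z [<-|/LK[w Kw <-]]].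
- by exists y => //; left.
- by exists w => //; right.
Qed.

(** Induction on the derivation: the lists of the premises are joined, and discharged or shifted
    hypotheses are traced back to [G]. *)
Lemma prf_compact X (G : set (form S X)) a : prf G a ->
  exists2 L, (forall x, List.In x L -> G x) & prf [set x | List.In x L] a.
Proof.
elim=> {X G a}.
- move=> X G a Ga; exists [:: a]; first by move=> x [<-|[]].
  by apply: prf_ax; left.
- move=> X G a b _ [L /sublist_setU[K KG LK] p]; exists K => //.
  by apply/prf_impI/(prf_weaken p) => x /LK.
- move=> X G a b _ [L LG p] _ [K KG q]; exists (L ++ K).
    by move=> x; rewrite List.in_app_iff => -[/LG|/KG].
  apply: (prf_impE (a := a)).
  + by apply: prf_weaken p _ => x Lx; apply: List.in_or_app; left.
  + by apply: prf_weaken q _ => x Lx; apply: List.in_or_app; right.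
- move=> X G a _ [L /sublist_setU[K KG LK] p]; exists K => //.
  by apply/prf_raa/(prf_weaken p) => x /LK.
- move=> X G a _ [L /sublist_image[K KG LK] p]; exists K => //.
  by apply/prf_allI/(prf_weaken p) => x /LK[y Ky <-]; exists y.
- by move=> X G a t _ [L LG p]; exists L => //; apply: prf_allE.
- by move=> X G t; exists nil => //; apply: prf_refl.
- move=> X G a s t _ [L LG p] _ [K KG q]; exists (L ++ K).
    by move=> x; rewrite List.in_app_iff => -[/LG|/KG].
  apply: (prf_leib (s := s)).
  + by apply: prf_weaken p _ => x Lx; apply: List.in_or_app; left.
  + by apply: prf_weaken q _ => x Lx; apply: List.in_or_app; right.
- by move=> X G; exists nil => //; apply: prf_inh.
Qed.

Definition consistent X (G : set (form S X)) := ~ prf G Bot.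

Lemma prf_efq X (G : set (form S X)) a : prf G Bot -> prf G a.
Proof. by move=> p; apply/prf_raa/(prf_weaken p) => x; left. Qed.

(** A contradiction over one more variable refutes in particular [Eq (Var None) (Var None)];
    generalising this contradicts [prf_inh]. *)
Lemma consistent_rename_Some X (G : set (form S X)) :
  consistent G -> consistent (rename Some @` G).
Proof.
move=> cG p; apply: cG; apply: prf_impE (prf_inh G) _.
by apply/prf_allI/prf_efq.
Qed.

(* All variables are identified with a single one, which is then removed by
   nonemptiness of the domain. *)
Lemma consistent_rename_void Y (G : set (sentence S)) (g : void -> Y) :
  consistent G -> consistent (rename g @` G).
Proof.
move=> /consistent_rename_Some cG p; apply: cG.
have q := prf_rename (fun=> None : option void) p.
apply: prf_weaken q _ => _ [_ [a Ga <-] <-].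
by exists a => //; rewrite rename_comp; congr rename; apply: funext => -[].
Qed.

End Derivability.

(** * Satisfaction and soundness *)

(* Function symbols denote arbitrary relations, the graphs of the functions,
   and identity denotes an arbitrary relation, so that a translation yields a
   structure before anything is known about it. *)
Record structure (S : signature) := Structure {
  carrier :> Type;
  eqv : carrier -> carrier -> Prop;
  graph : forall f : fsym S, ('I_(far f) -> carrier) -> carrier -> Prop;
  holds : forall r : rsym S, ('I_(rar r) -> carrier) -> Prop }.

Section Satisfaction.
Variable S : signature.
Implicit Types M : structure S.

Fixpoint has_value M (X : Type) (t : term S X) (rho : X -> M) (y : M) : Prop :=
  match t with
  | Var x => y = rho x
  | App f ts =>
      exists2 ys, forall k, has_value (ts k) rho (ys k) & graph ys y
  end.

Definition extend (X D : Type) (rho : X -> D) (d : D) (o : option X) : D :=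
  if o is Some x then rho x else d.

(** Atoms are existential in the values of their terms, just as [translate] unravels them; this
    makes sense even if values are missing or not unique. *)
Fixpoint sat M (X : Type) (a : form S X) : (X -> M) -> Prop :=
  match a with
  | Bot => fun rho => False
  | Eq s t => fun rho =>
      exists u v, [/\ has_value s rho u, has_value t rho v & eqv u v]
  | Rel r ts => fun rho =>
      exists2 ys, forall k, has_value (ts k) rho (ys k) & holds ys
  | Imp b c => fun rho => sat b rho -> sat c rho
  | All b => fun rho => forall d, sat b (extend rho d)
  end.

Lemma has_value_trename M X Y (g : X -> Y) t (rho : Y -> M) y :
  has_value (trename g t) rho y <-> has_value t (rho \o g) y.
Proof.
elim: t y => //= f ts IH y.
by split=> -[ys vs fy]; exists ys => // k; apply/IH.
Qed.

Lemma sat_rename M X Y (g : X -> Y) a (rho : Y -> M) :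
  sat (rename g a) rho <-> sat a (rho \o g).
Proof.
elim: a Y g rho => //= {X}.
- move=> X s t Y g rho.
  split=> -[u [v [/has_value_trename su /has_value_trename tv uv]]];
    by exists u, v.
- move=> X r ts Y g rho.
  by split=> -[ys vs ry]; exists ys => // k; apply/has_value_trename.
- by move=> X a IHa b IHb Y g rho; rewrite IHa IHb.
- move=> X a IH Y g rho; split=> H d; move: (H d); rewrite IH.
  + by congr sat; apply: funext => -[].
  + by congr sat; apply: funext => -[].
Qed.

Lemma sat_Neg M X (a : form S X) (rho : X -> M) :
  sat (Neg a) rho <-> ~ sat a rho.
Proof. by []. Qed.

Lemma sat_And M X (a b : form S X) (rho : X -> M) :
  sat (And a b) rho <-> sat a rho /\ sat b rho.
Proof. rewrite /=; case: (EM (sat a rho)); case: (EM (sat b rho)); tauto. Qed.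

Lemma sat_Or M X (a b : form S X) (rho : X -> M) :
  sat (Or a b) rho <-> sat a rho \/ sat b rho.
Proof. rewrite /=; case: (EM (sat a rho)); tauto. Qed.

Lemma sat_Ex M X (a : form S (option X)) (rho : X -> M) :
  sat (Ex a) rho <-> exists d, sat a (extend rho d).
Proof.
rewrite /=; split=> [H|[d ad] /(_ d)]; last exact.
by apply: contrapT => nex; apply: H => d ad; apply: nex; exists d.
Qed.

Lemma sat_bigAnd M X (I : finType) (a : I -> form S X) (rho : X -> M) :
  sat (\big[@And S X/Top]_i a i) rho <-> forall i, sat (a i) rho.
Proof.
suff H (s : seq I) :
    sat (\big[@And S X/Top]_(i <- s) a i) rho <->
    forall i, i \in s -> sat (a i) rho.
  rewrite H; split=> K i; last by move=> _; apply: K.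
  by apply: K; exact: mem_index_enum.
elim: s => [|i s IH]; first by rewrite big_nil; split=> // _.
rewrite big_cons sat_And IH.
split=> [[ai as_] j|H]; last first.
  by split=> [|j js]; apply: H; rewrite inE ?eqxx ?js ?orbT.
by rewrite inE => /predU1P[->|/as_].
Qed.

Lemma sat_bigOr M X (I : finType) (a : I -> form S X) (rho : X -> M) :
  sat (\big[@Or S X/Bot]_i a i) rho <-> exists i, sat (a i) rho.
Proof.
suff H (s : seq I) :
    sat (\big[@Or S X/Bot]_(i <- s) a i) rho <->
    exists2 i, i \in s & sat (a i) rho.
  by rewrite H; split=> -[i]; exists i => //; exact: mem_index_enum.
elim: s => [|i s IH]; first by rewrite big_nil; split=> // -[].
rewrite big_cons sat_Or IH; split=> [[ai|[j js aj]]|[j]].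
- by exists i => //; rewrite inE eqxx.
- by exists j => //; rewrite inE js orbT.
- by rewrite inE => /predU1P[->|js] aj; [left | right; exists j].
Qed.

Definition sum_env (X I D : Type) (rho : X -> D) (w : I -> D) (y : X + I) : D :=
  match y with inl x => rho x | inr i => w i end.

Lemma sat_all_ord M d X (a : form S (X + 'I_d)) (rho : X -> M) :
  sat (all_ord a) rho <-> forall w, sat a (sum_env rho w).
Proof.
elim: d X a rho => [|d IH] X a rho /=.
  rewrite sat_rename; split=> [H w|/(_ (fun i => False_rect _ (notF (ltn_ord i))))].
  + by move: H; congr sat; apply: funext => -[] // -[].
  + by congr sat; apply: funext => -[] // -[].
split=> H => [w|u].
- move/IH: (H (w ord0)) => /(_ (w \o lift ord0)); rewrite sat_rename.
  congr sat; apply: funext => -[x|i] //=.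
  by case: unliftP => [j ->|->].
- rewrite IH => w; rewrite sat_rename.
  have := H (fun i => if unlift ord0 i is Some j then w j else u).
  by congr sat; apply: funext => -[x|i] //=; case: unlift.
Qed.

Lemma sat_all_block M X (I : finType) (a : form S (X + I)) (rho : X -> M) :
  sat (all_block a) rho <-> forall w, sat a (sum_env rho w).
Proof.
rewrite sat_all_ord; split=> H w.
- move: (H (w \o enum_val)); rewrite sat_rename; congr sat.
  by apply: funext => -[x|i] //=; rewrite enum_rankK.
- rewrite sat_rename; move: (H (w \o enum_rank)); congr sat.
  by apply: funext => -[].
Qed.

Lemma sat_ex_block M X (I : finType) (a : form S (X + I)) (rho : X -> M) :
  sat (ex_block a) rho <-> exists w, sat a (sum_env rho w).
Proof.
rewrite sat_Neg sat_all_block; split=> [H|[w aw] /(_ w)]; last exact.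
by apply: contrapT => nex; apply: H => w aw; apply: nex; exists w.
Qed.

(** Identity is a congruence rather than equality, and functions are single-valued up to it. Graphs
    are not asked to be closed under [eqv] in the value, so a term model qualifies without forming a
    quotient. *)
Record normal M : Prop := Normal {
  normal_inh : exists d : M, True;
  normal_refl : forall u : M, eqv u u;
  normal_sym : forall u v : M, eqv u v -> eqv v u;
  normal_trans : forall u v w : M, eqv u v -> eqv v w -> eqv u w;
  normal_total : forall f (us : _ -> M), exists v, graph (f := f) us v;
  normal_graph : forall f (us vs : _ -> M) u v,
    (forall k, eqv (us k) (vs k)) ->
    graph (f := f) us u -> graph vs v -> eqv u v;
  normal_holds : forall r (us vs : _ -> M),
    (forall k, eqv (us k) (vs k)) -> holds (r := r) us -> holds vs }.

(** * Values and substitution in normal structures *)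

Section Normal.
Variables (M : structure S) (nM : normal M).

Lemma has_value_total X (t : term S X) (rho : X -> M) :
  exists y, has_value t rho y.
Proof.
elim: t => [x|f ts /choice[ys vs]]; first by exists (rho x).
by have [y fy] := normal_total nM (f := f) ys; exists y, ys.
Qed.

Lemma has_value_eqv X (t : term S X) (rho rho' : X -> M) y y' :
  (forall x, eqv (rho x) (rho' x)) ->
  has_value t rho y -> has_value t rho' y' -> eqv y y'.
Proof.
move=> E; elim: t y y' => [x|f ts IH] y y' /=; first by move=> -> ->.
move=> [ys vs fy] [ys' vs' fy']; apply: normal_graph fy fy' => // k.
exact: IH (vs k) (vs' k).
Qed.

Lemma eqv_extend X (rho rho' : X -> M) d :
  (forall x, eqv (rho x) (rho' x)) ->
  forall o, eqv (extend rho d o) (extend rho' d o).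
Proof. by move=> E [x|] /=; [exact: E | exact: normal_refl]. Qed.

Lemma has_value_tsubst X Y (g : X -> term S Y) t (rho : Y -> M) rho' y y' :
  (forall x, has_value (g x) rho (rho' x)) ->
  has_value (tsubst g t) rho y -> has_value t rho' y' -> eqv y y'.
Proof.
move=> G; elim: t y y' => [x|f ts IH] y y' /=.
  move=> gy ->; apply: has_value_eqv gy (G x) => z; exact: normal_refl.
move=> [ys vs fy] [ys' vs' fy']; apply: normal_graph fy fy' => // k.
exact: IH (vs k) (vs' k).
Qed.

(** Any values [rho' x] of the substituted terms will do, because values exist and are unique up to
    [eqv]. *)
Lemma sat_subst X Y (g : X -> term S Y) a (rho : Y -> M) rho' :
  (forall x, has_value (g x) rho (rho' x)) ->
  sat (subst g a) rho <-> sat a rho'.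
Proof.
elim: a Y g rho rho' => //= {X}.
- move=> X s t Y g rho rho' G; split=> -[u [v [su tv uv]]].
  + have [u' su'] := has_value_total s rho'.
    have [v' tv'] := has_value_total t rho'; exists u', v'; split=> //.
    have vv' := has_value_tsubst G tv tv'.
    have uu' := has_value_tsubst G su su'.
    exact: normal_trans (normal_sym nM uu') (normal_trans nM uv vv').
  + have [u' su'] := has_value_total (tsubst g s) rho.
    have [v' tv'] := has_value_total (tsubst g t) rho; exists u', v'; split=> //.
    have vv' := has_value_tsubst G tv' tv.
    have uu' := has_value_tsubst G su' su.
    exact: normal_trans uu' (normal_trans nM uv (normal_sym nM vv')).
- move=> X r ts Y g rho rho' G; split=> -[ys vs ry].
  + have [ys' vs'] := choice (fun k => has_value_total (ts k) rho').
    exists ys' => //; apply: normal_holds ry => // k.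
    exact: has_value_tsubst G (vs k) (vs' k).
  + have [ys' vs'] := choice (fun k => has_value_total (tsubst g (ts k)) rho).
    exists ys' => //; apply: normal_holds ry => // k.
    exact/(normal_sym nM)/(has_value_tsubst G (vs' k) (vs k)).
- by move=> X a IHa b IHb Y g rho rho' G; rewrite (IHa _ _ _ _ G) (IHb _ _ _ _ G).
- move=> X a IH Y g rho rho' G.
  have G' d o : has_value (up g o) (extend rho d) (extend rho' d o).
    by case: o => [x|] //=; apply/has_value_trename/G.
  by split=> H d; apply/(IH _ _ _ _ (G' d)).
Qed.

Lemma sat_inst X t (a : form S (option X)) (rho : X -> M) d :
  has_value t rho d -> sat (inst t a) rho <-> sat a (extend rho d).
Proof. by move=> td; apply: sat_subst => -[]. Qed.

Lemma sat_eqv X (a : form S X) (rho rho' : X -> M) :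
  (forall x, eqv (rho x) (rho' x)) -> sat a rho -> sat a rho'.
Proof.
(* The claim is strengthened to an equivalence because implication is contravariant in its
   premise. *)
move=> E; suff: sat a rho <-> sat a rho' by case.
elim: a rho rho' E => //= {X}.
- move=> X s t rho rho' E.
  split=> -[u [v [su tv uv]]].
  + have [u' su'] := has_value_total s rho'.
    have [v' tv'] := has_value_total t rho'; exists u', v'; split=> //.
    have vv' := has_value_eqv E tv tv'.
    have uu' := has_value_eqv E su su'.
    exact: normal_trans (normal_sym nM uu') (normal_trans nM uv vv').
  + have [u' su'] := has_value_total s rho.
    have [v' tv'] := has_value_total t rho; exists u', v'; split=> //.
    have vv' := has_value_eqv E tv' tv.
    have uu' := has_value_eqv E su' su.
    exact: normal_trans uu' (normal_trans nM uv (normal_sym nM vv')).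
- move=> X r ts rho rho' E; split=> -[ys vs ry].
  + have [ys' vs'] := choice (fun k => has_value_total (ts k) rho').
    exists ys' => //; apply: normal_holds ry => // k.
    exact: has_value_eqv E (vs k) (vs' k).
  + have [ys' vs'] := choice (fun k => has_value_total (ts k) rho).
    exists ys' => //; apply: normal_holds ry => // k.
    exact/(normal_sym nM)/(has_value_eqv E (vs' k) (vs k)).
- by move=> X a IHa b IHb rho rho' E; rewrite (IHa _ _ E) (IHb _ _ E).
- move=> X a IH rho rho' E.
  by split=> H d; apply/(IH _ _ (eqv_extend d E)).
Qed.

End Normal.

Theorem soundness M X (G : set (form S X)) a (rho : X -> M) :
  normal M -> prf G a -> (forall b, G b -> sat b rho) -> sat a rho.
Proof.
move=> nM p; elim: p rho => {X G a}.
- by move=> X G a Ga rho; apply.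
- by move=> X G a b _ IH rho HG sa; apply: IH => c [/HG|->].
- by move=> X G a b _ IHa _ IHb rho HG; apply: IHa (IHb _ HG).
- move=> X G a _ IH rho HG; apply: contrapT => na.
  by apply: (IH rho) => c [/HG|->].
- move=> X G a _ IH rho HG d; apply: IH => _ [b Gb <-].
  by rewrite sat_rename; apply: HG.
- move=> X G a t _ IH rho HG; have [d td] := has_value_total nM t rho.
  by rewrite (sat_inst nM a td); apply: IH.
- move=> X G t rho _; have [d td] := has_value_total nM t rho.
  by exists d, d; split=> //; apply: normal_refl.
- move=> X G a s t _ IHe _ IH rho HG.
  have [u [v [su tv uv]]] := IHe _ HG; move: (IH _ HG).
  rewrite (sat_inst nM a su) (sat_inst nM a tv); apply: sat_eqv => // -[x|] //=.
  exact: normal_refl.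
- move=> X G rho _; have [d _] := normal_inh nM; apply/sat_Ex; exists d.
  by exists d, d; split=> //; apply: normal_refl.
Qed.

End Satisfaction.

(** * Henkin axioms *)

Section Coding.
Variable S : signature.

Lemma code_inj : injective CodeSeq.code.
Proof. exact: can_inj CodeSeq.codeK. Qed.

Lemma map_enum_inj n (T T' : Type) (f : T -> T') (x y : 'I_n -> T) :
  (forall k z, f (x k) = f z -> x k = z) ->
  [seq f (x k) | k <- enum 'I_n] = [seq f (y k) | k <- enum 'I_n] -> x = y.
Proof.
move=> inj /eq_in_map E; apply: funext => k; apply/inj/E.
by rewrite mem_enum.
Qed.

Lemma code_term_inj (X : Type) (c : X -> nat) :
  injective c -> injective (code_term (S := S) c).
Proof.
move=> c_inj s; elim: s => [x|f ts IH] [y|f' ts'] /code_inj [] //.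
  by move=> /c_inj ->.
by move=> /ord_inj ff'; move: ff' ts' => <- ts' /map_enum_inj-> //.
Qed.

Lemma code_form_inj (X : Type) (c : X -> nat) :
  injective c -> injective (code_form (S := S) c).
Proof.
move=> c_inj a; elim: a c c_inj => {X}.
- by move=> X c _ [||||] // > /code_inj.
- move=> X s t c c_inj [||||] //; try by move=> > /code_inj.
  by move=> s' t' /code_inj[/(code_term_inj c_inj)-> /(code_term_inj c_inj)->].
- move=> X r ts c c_inj [||||] //; try by move=> > /code_inj.
  move=> r' ts' /code_inj[/ord_inj rr']; move: rr' ts' => <- ts'.
  by move=> /map_enum_inj-> // k z /(code_term_inj c_inj).
- move=> X a IHa b IHb c c_inj [||||] //; try by move=> > /code_inj.
  by move=> a' b' /code_inj[/(IHa _ c_inj)-> /(IHb _ c_inj)->].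
- move=> X a IH c c_inj [||||] //; try by move=> > /code_inj.
  by move=> b /code_inj[/IH-> //] [x|] [y|] // [/c_inj->].
Qed.

End Coding.

Section Henkin.
Variable S : signature.

(** Formulas are finite in their variables; agreement of renamings expresses this without a notion
    of occurrence. The numbering [c] of an arbitrary type lets the induction pass through
    binders. *)
Lemma form_bound (X : Type) (c : X -> nat) (a : form S X) :
  exists n, forall (Y : Type) (g h : X -> Y),
    (forall x, c x < n -> g x = h x) -> rename g a = rename h a.
Proof.
have term_bound Z (d : Z -> nat) (t : term S Z) :
    exists n, forall (Y : Type) (g h : Z -> Y),
      (forall z, d z < n -> g z = h z) -> trename g t = trename h t.
  elim: t => [z|f ts /choice[n H]].
    by exists (d z).+1 => Y g h /(_ z (ltnSn _)) /= ->.
  exists (\max_k n k) => Y g h E /=; congr App; apply: funext => k.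
  by apply: H => z zn; apply/E/(leq_trans zn)/leq_bigmax.
elim: a c => {X}.
- by move=> X c; exists 0.
- move=> X s t c; have [m Hm] := term_bound X c s.
  have [n Hn] := term_bound X c t; exists (maxn m n) => Y g h E /=.
  by congr Eq; [apply: Hm | apply: Hn] => z zn; apply: E;
    rewrite leq_max zn ?orbT.
- move=> X r ts c; have /choice[n H] := fun k => term_bound X c (ts k).
  exists (\max_k n k) => Y g h E /=; congr Rel; apply: funext => k.
  by apply: H => z zn; apply/E/(leq_trans zn)/leq_bigmax.
- move=> X a IHa b IHb c; have [m Hm] := IHa c.
  have [n Hn] := IHb c; exists (maxn m n) => Y g h E /=.
  by congr Imp; [apply: Hm | apply: Hn] => z zn; apply: E;
    rewrite leq_max zn ?orbT.
- move=> X a IH c.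
  (* The body is numbered with [c] shifted by one to make room for [None]; its bound is still valid,
     if generous, for the unshifted numbers. *)
  have [n H] := IH (fun o => if o is Some x then (c x).+1 else 0).
  exists n => Y g h E /=; congr All; apply: H => -[x|] //= xn.
  by rewrite E // ltnW.
Qed.

Definition bounds n (a : form S nat) := forall (Y : Type) (g h : nat -> Y),
  (forall x, x < n -> g x = h x) -> rename g a = rename h a.

Lemma bounds_leq m n a : m <= n -> bounds m a -> bounds n a.
Proof. by move=> mn H Y g h E; apply: H => x xm; apply/E/(leq_trans xm). Qed.

(* The renaming sends the fresh variable [n] to [None]. *)
Lemma prf_allI_fresh n (G : set (form S nat)) (a : form S (option nat)) :
  (forall b, G b -> bounds n b) -> bounds n (All a) ->
  prf G (inst (Var n) a) -> prf G (All a).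
Proof.
move=> Gn an /(prf_rename (fun x => if x == n then None else Some x)) p.
have E x : x < n -> (if x == n then None else Some x) = Some x.
  by move=> xn; rewrite ltn_eqF.
apply: prf_allI; move: p; rewrite rename_inst /= eqxx.
(* Below [n] the renaming agrees with [Some], so the renamed body is a mere shift, and instantiating
   it with [None] gives back [a]. *)
have /= [->] := an _ _ _ E.
rewrite /inst renameE subst_comp (_ : _ \o _ = Var); last first.
  by apply: funext => -[].
rewrite subst_id => p; apply: prf_weaken p _ => _ [b Gb <-].
by exists b => //; rewrite (Gn _ Gb _ _ _ E).
Qed.

(** A classical inverse of the Goedel numbering. The default [Bot] at numbers of no formula is
    harmless, as only surjectivity matters. *)
Definition nth_form (k : nat) : form S (option nat) :=
  if pselect (exists a, code_form (oapp succn 0) a = k) is left H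
  then projT1 (cid H) else Bot.

Lemma nth_form_surj a : exists k, nth_form k = a.
Proof.
exists (code_form (oapp succn 0) a); rewrite /nth_form.
case: pselect => [H|[]]; last by exists a.
case: cid => b /=; apply: code_form_inj => -[x|] [y|] //=; congruence.
Qed.

Definition nth_bound k := projT1 (cid (form_bound id (All (nth_form k)))).

Lemma nth_boundP k : bounds (nth_bound k) (All (nth_form k)).
Proof. by rewrite /nth_bound; case: cid. Qed.

(** Summing dominates all bounds so far, and the added ones make the sequence strictly increasing;
    so [witness k] is fresh for the formulas up to [k] and differs from earlier witnesses. *)
Definition witness k := \sum_(j < k.+1) (nth_bound j).+1.

Lemma nth_bound_witness j k : j <= k -> nth_bound j <= witness k.
Proof.
move=> jk; rewrite /witness (bigD1 (Ordinal (n := k.+1) jk)) //=.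
by rewrite (leq_trans (leqnSn _)) ?leq_addr.
Qed.

Lemma witness_ltn j k : j < k -> witness j < witness k.
Proof.
elim: k => // k IH; rewrite ltnS leq_eqVlt => jk.
have H : witness k < witness k.+1.
  by rewrite /witness [ltnRHS]big_ord_recr /= addnS ltnS leq_addr.
by case/predU1P: jk => [->|/IH /ltn_trans ->].
Qed.

(** The universal form of the witness property: [witness k] is a counterexample to [nth_form k] if
    there is one. *)
Definition henkin_axiom k :=
  Imp (inst (Var (witness k)) (nth_form k)) (All (nth_form k)).

Lemma henkin_axiom_bounds j k : j < k -> bounds (witness k) (henkin_axiom j).
Proof.
move=> jk; have jb := bounds_leq (nth_bound_witness (ltnW jk)) (@nth_boundP j).
move=> Y g h E /=; rewrite !rename_inst /= (E _ (witness_ltn jk)).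
by have /= [->] := jb _ _ _ E.
Qed.

Definition henkin (G : set (sentence S)) (g : void -> nat) m :
    set (form S nat) :=
  rename g @` G `|` [set henkin_axiom k | k in [set k | k < m]].

(** Induction on [m]: if the newest axiom were refutable, its premise would be provable and, the
    witness being fresh, so would its conclusion, which proves the axiom after all. *)
Lemma henkin_consistent G (g : void -> nat) m :
  consistent G -> consistent (henkin G g m).
Proof.
move=> /(@consistent_rename_void _ _ _ g) cG; elim: m => [|m IH] p.
  by apply: cG; apply: prf_weaken p _ => b [//|[k]].
apply: IH.
have {}p : prf (henkin G g m) (Neg (henkin_axiom m)).
  apply/prf_impI/(prf_weaken p) => b [Gb|[k /=]]; first by left; left.
  rewrite ltnS leq_eqVlt => /predU1P[->|km] <-; first by right.
  by left; right; exists k.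
have K (b : form S nat) :
    prf (henkin G g m `|` [set b]) (henkin_axiom m) ->
    prf (henkin G g m `|` [set b]) Bot.
  by move=> q; apply: prf_impE q; apply: (prf_weaken p); left.
(* The negated premise proves the implication vacuously, hence is contradictory by [K]. *)
have q : prf (henkin G g m) (inst (Var (witness m)) (nth_form m)).
  apply/prf_raa/K/prf_impI/prf_efq.
  apply: (prf_impE (a := inst (Var (witness m)) (nth_form m))).
    by apply: prf_ax; left; right.
  by apply: prf_ax; right.
apply: prf_impE p _; apply: prf_impI.
apply: (prf_weaken (G := henkin G g m)); last by left.
apply: prf_allI_fresh q => [b|]; last first.
  exact: bounds_leq (nth_bound_witness (leqnn m)) (@nth_boundP m).
case=> [[c _ <-]|[k /= km <-]]; last exact: henkin_axiom_bounds.
by move=> Y h h' _; rewrite !rename_comp; congr rename; apply: funext => -[].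
Qed.

End Henkin.

(** * Completeness *)

Section Completeness.
Variable S : signature.

(** Of finitely many members of a chain one is the largest. The first alternative is there because
    the chain may be empty. *)
Lemma sublist_chain T (G : set T) (F : set (set T)) (L : seq T) :
  total_on F subset -> (forall x, List.In x L -> (G `|` \bigcup_(A in F) A) x) ->
  (forall x, List.In x L -> G x) \/
  exists2 A, F A & forall x, List.In x L -> (G `|` A) x.
Proof.
move=> tF; elim: L => [|x L IH] LGF; first by left.
have {}IH := IH (fun y Ly => LGF y (or_intror Ly)).
have [Gx|[A FA Ax]] := LGF x (or_introl erefl).
  case: IH => [LG|[A FA LA]]; [left | right; exists A => //] => y [<-|] //.
  - exact: LG.
  - by left.
  - exact: LA.
right; case: IH => [LG|[B FB LB]].
  by exists A => // y [<-|/LG]; [right | left].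
have [AB|BA] := tF _ _ FA FB.
  by exists B => // y [<-|/LB //]; right; apply: AB.
by exists A => // y [<-|/LB[]]; [right | left | right; apply: BA].
Qed.

Lemma lindenbaum X (G : set (form S X)) : consistent G ->
  exists D, [/\ G `<=` D, consistent D & forall a, D a \/ D (Neg a)].
Proof.
move=> cG.
(* Zorn's lemma is applied to the sets consistent with [G], not to supersets of [G], since the union
   of the empty chain must qualify. *)
have [F FP tF|D [cD maxD]] := @Zorn_bigcup _ [set D | consistent (G `|` D)].
  move=> p; have [L LGF q] := prf_compact p.
  have [LG|[A FA LA]] := sublist_chain tF LGF; first exact/cG/(prf_weaken q).
  exact/(FP _ FA)/(prf_weaken q).
have ext b : consistent (G `|` (D `|` [set b])) -> D b.
  move=> cDb; apply: contrapT => nDb; apply: (maxD (D `|` [set b])) => //.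
  by split=> [|DD]; [left | apply: nDb; apply: DD; right].
exists (G `|` D); split=> // a.
apply: contrapT => /not_orP[nDa nDna]; apply: cD.
have {}nDa : prf (G `|` D) (Neg a).
  apply: prf_impI; apply: contrapT => c; apply: nDa; right; apply: ext.
  by move=> p; apply: c; rewrite -setUA.
apply: prf_impE nDa _; apply: prf_raa; apply: contrapT => c.
apply: nDna; right; apply: ext => p; apply: c; rewrite -setUA //.
Qed.

Lemma prf_eq_sym X (G : set (form S X)) s t : prf G (Eq s t) -> prf G (Eq t s).
Proof.
move=> p; have := prf_leib (a := Eq (Var None) (trename Some s)) p.
rewrite /inst /= !trenameE !tsubst_comp (_ : _ \o _ = Var) // tsubst_id.
by apply; apply: prf_refl.
Qed.

(** Leibniz's rule replaces one variable at a time; the list [l] holds those already treated. *)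
Lemma prf_subst_eq (I : finType) X (G : set (form S X)) (a : form S I) ss ts :
  (forall i, prf G (Eq (ss i) (ts i))) -> prf G (subst ss a) ->
  prf G (subst ts a).
Proof.
move=> E p.
suff H (l : seq I) : prf G (subst (fun i => if i \in l then ts i else ss i) a).
  by move: (H (enum I)); congr (prf _ (subst _ _)); apply: funext => i;
    rewrite mem_enum.
elim: l => [|j l IH]; first by move: p; congr (prf _ (subst _ _)); apply: funext.
have [jl|jl] := boolP (j \in l).
  move: IH; congr (prf _ (subst _ _)); apply: funext => i; rewrite inE.
  by case: eqP => [->|//]; rewrite jl.
(* The place [j] is left open in [b]; the others carry their current terms. *)
pose b := subst (fun i => if i == j then Var None else
  trename Some (if i \in l then ts i else ss i)) a.
have bE t : inst t b =
    subst (fun i => if i == j then t else if i \in l then ts i else ss i) a.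
  rewrite /inst subst_comp; congr subst; apply: funext => i /=.
  case: eqP => //= _; rewrite trenameE tsubst_comp.
  by rewrite -[RHS]tsubst_id.
have := prf_leib (a := b) (E j); rewrite !bE => q.
have {q} : prf G (subst (fun i => if i == j then ts j else
    if i \in l then ts i else ss i) a).
  apply: q; move: IH; congr (prf _ (subst _ _)); apply: funext => i.
  by case: eqP => // ->; rewrite (negPf jl).
congr (prf _ (subst _ _)); apply: funext => i; rewrite inE.
by case: eqP => // ->.
Qed.

Lemma prf_eq_trans X (G : set (form S X)) s t u :
  prf G (Eq s t) -> prf G (Eq t u) -> prf G (Eq s u).
Proof.
move=> st tu; have := prf_leib (a := Eq (trename Some s) (Var None)) tu.
rewrite /inst /= !trenameE !tsubst_comp (_ : _ \o _ = Var) // tsubst_id.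
exact.
Qed.

Lemma prf_App_eq X (G : set (form S X)) (f : fsym S) (ss ts : 'I_(far f) -> _) :
  (forall k, prf G (Eq (ss k) (ts k))) -> prf G (Eq (App ss) (App ts)).
Proof.
move=> E.
(* The [false] copy of the variables keeps [ss] while the [true] copy passes from [ss] to [ts],
   starting from reflexivity. *)
pose a : form S (bool * 'I_(far f)) :=
  Eq (App (fun k => Var (false, k))) (App (fun k => Var (true, k))).
pose env (us : 'I_(far f) -> term S X) (x : bool * 'I_(far f)) :=
  if x.1 then us x.2 else ss x.2.
have := @prf_subst_eq _ _ G a (env ss) (env ts); apply; last exact: prf_refl.
by move=> [[] k]; [exact: E | exact: prf_refl].
Qed.

Lemma prf_Rel_eq X (G : set (form S X)) (r : rsym S) (ss ts : 'I_(rar r) -> _) :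
  (forall k, prf G (Eq (ss k) (ts k))) -> prf G (Rel ss) -> prf G (Rel ts).
Proof. exact: (@prf_subst_eq _ _ _ (Rel Var)). Qed.

(** * The term model of a complete Henkin set *)

Section TermModel.
Variable D : set (form S nat).
Hypothesis cD : consistent D.
Hypothesis completeD : forall a, D a \/ D (Neg a).
Hypothesis henkinD : forall k, D (henkin_axiom S k).

Definition term_model : structure S :=
  Structure (carrier := term S nat)
    (fun s t => prf D (Eq s t))
    (fun f ts t => t = App ts)
    (fun r ts => prf D (Rel ts)).

Lemma term_model_value X (t : term S X) (rho : X -> term S nat) y :
  has_value (M := term_model) t rho y <-> y = tsubst rho t.
Proof.
elim: t y => //= f ts IH y; split=> [[ys vs ->]|->].
  by congr App; apply: funext => k; apply/IH.
by exists (fun k => tsubst rho (ts k)) => // k; apply/IH.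
Qed.

(** Completeness of [D] settles implication. For the quantifier, the Henkin axiom makes the instance
    at the witness imply the universal formula. *)
Lemma truth X (a : form S X) (rho : X -> term S nat) :
  sat (M := term_model) a rho <-> prf D (subst rho a).
Proof.
elim: a rho => {X}.
- by move=> X rho; split=> // /cD.
- move=> X s t rho /=; split=> [[u [v [/term_model_value-> /term_model_value->]]]//|p].
  by exists (tsubst rho s), (tsubst rho t); split=> //; apply/term_model_value.
- move=> X r ts rho /=; split=> [[ys vs]|p].
    by rewrite (_ : ys = fun k => tsubst rho (ts k)) //; apply: funext => k;
      apply/term_model_value.
  by exists (fun k => tsubst rho (ts k)) => // k; apply/term_model_value.
- move=> X a IHa b IHb rho /=; rewrite IHa IHb; split=> [ab|p q]; last first.
    exact: prf_impE p q.
  have [/ab q|na] := EM (prf D (subst rho a)).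
    by apply/prf_impI/(prf_weaken q); left.
  apply/prf_impI/prf_efq/prf_impE/prf_ax; last by right.
  apply: (@prf_weaken _ _ D); last by left.
  by have [/prf_ax/na|/prf_ax] := completeD (subst rho a).
- move=> X a IH rho /=.
  have E t : subst (extend rho t) a = inst t (subst (up rho) a).
    rewrite /inst subst_comp; congr subst; apply: funext => -[x|] //=.
    by rewrite trenameE tsubst_comp -[LHS]tsubst_id.
  split=> [H|p t]; last by apply/IH; rewrite E; apply: prf_allE.
  have [k kE] := nth_form_surj (subst (up rho) a).
  have := prf_ax (henkinD k); rewrite /henkin_axiom kE => p.
  by apply: prf_impE p _; rewrite -E; apply/IH/H.
Qed.

Lemma term_model_normal : normal term_model.
Proof.
split=> /=.
- by exists (Var 0).
- by move=> u; apply: prf_refl.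
- by move=> u v; apply: prf_eq_sym.
- by move=> u v w; apply: prf_eq_trans.
- by move=> f us; exists (App us).
- by move=> f us vs u v E -> ->; apply: prf_App_eq.
- by move=> r us vs; apply: prf_Rel_eq.
Qed.

End TermModel.

Definition void_env (D : Type) (x : void) : D := match x with end.

Definition models (M : structure S) (a : sentence S) := sat a (void_env M).

(** If [a] is not provable, the Henkin axioms are consistent with [G] and [Neg a], and the term
    model of a complete extension satisfies [G] but not [a]. *)
Theorem completeness (G : theory S) a :
  (forall M : structure S, normal M -> (forall b, G b -> models M b) ->
     models M a) ->
  prf G a.
Proof.
move=> Ga; apply: prf_raa; apply: contrapT => cG.
have cH : consistent (rename (void_env nat) @` (G `|` [set Neg a]) `|`
    [set henkin_axiom S k | k in [set: nat]]).
  move=> p; have [L LH q] := prf_compact p.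
  (* The finite list [L] involves only finitely many Henkin axioms, all present at some stage
     [m]. *)
  have [m LHm] : exists m, forall x, List.In x L ->
      henkin (G `|` [set Neg a]) (void_env nat) m x.
    elim: L LH {q} => [|x L IH] LH; first by exists 0.
    have [m LHm] := IH (fun y Ly => LH y (or_intror Ly)).
    have [xG|[k _ xk]] := LH x (or_introl erefl).
      by exists m => y [<-|/LHm //]; left.
    exists (maxn m k.+1) => y [<-|/LHm[yG|[j /= jm yj]]].
    - by right; exists k => //=; rewrite leq_max ltnSn orbT.
    - by left.
    - by right; exists j => //=; rewrite leq_max jm.
  exact: (henkin_consistent (g := void_env nat) (m := m) cG (prf_weaken q LHm)).
have [D [HD cD completeD]] := lindenbaum cH.
have henkinD k : D (henkin_axiom S k) by apply: HD; right; exists k.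
have T b : models (term_model D) b <-> prf D (rename (void_env nat) b).
  rewrite /models (truth cD completeD henkinD) renameE.
  by rewrite (_ : Var \o _ = void_env _) //; apply: funext => -[].
have G'T b : (G `|` [set Neg a]) b -> models (term_model D) b.
  by move=> Gb; apply/T/prf_ax/HD; left; exists b.
have : models (term_model D) (Neg a) by apply: G'T; right.
apply.
by apply: Ga (term_model_normal D) _ => b Gb; apply: G'T; left.
Qed.

End Completeness.

(** * The structure defined by a translation *)

Section Translation.
Variables (S T : signature) (tau : translation S T) (M : structure T).

(* The objects of this structure are objects whose variables are the elements
   of [M] itself, each evaluated to itself. *)
Definition translated : structure S :=
  Structure (carrier := {o : obj tau M | sat (M := M) (dom_at o) id})
    (fun o o' => sat (M := M) (eq_at (sval o) (sval o')) id)
    (fun f os o => sat (M := M) (fun_at (sval \o os) (sval o)) id)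
    (fun r os => sat (M := M) (rel_at (sval \o os)) id).

Definition translated_obj (o : obj tau M) (od : sat (M := M) (dom_at o) id) :
    translated :=
  exist _ o od.

Lemma sval_translated_inj (o o' : translated) : sval o = sval o' -> o = o'.
Proof.
case: o o' => [o Ho] [o' Ho'] /= E; move: Ho'; rewrite -E => Ho'.
by congr exist; apply: Prop_irrelevance.
Qed.

Section Environment.
Variables (Y : Type) (e : Y -> M).

(** This and the next lemmas move the assignment [e] into the objects, so that all atoms are
    compared over [M] itself under [id]. *)
Lemma sat_dom_at (o : obj tau Y) :
  sat (dom_at o) e <-> sat (M := M) (dom_at (obj_map e o)) id.
Proof. by rewrite !sat_rename. Qed.

Lemma sat_eq_at (o o' : obj tau Y) :
  sat (eq_at o o') e <->
  sat (M := M) (eq_at (obj_map e o) (obj_map e o')) id.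
Proof.
rewrite !sat_rename; split; congr (sat (M := M) (eqf _ _));
  by apply: funext => -[].
Qed.

Lemma sat_rel_at (r : rsym S) (os : 'I_(rar r) -> obj tau Y) :
  sat (rel_at os) e <->
  sat (M := M) (rel_at (fun k => obj_map e (os k))) id.
Proof. by rewrite !sat_rename. Qed.

Lemma sat_fun_at (f : fsym S) (os : 'I_(far f) -> obj tau Y) (o : obj tau Y) :
  sat (fun_at os o) e <->
  sat (M := M) (fun_at (fun k => obj_map e (os k)) (obj_map e o)) id.
Proof.
rewrite !sat_rename; split; congr (sat (M := M) (funf _ _));
  by apply: funext => -[].
Qed.

Lemma value_obj_map (X : Type) (rho : X -> obj tau Y) (t : term S X)
    (z : nodes t -> obj tau Y) :
  value (obj_map e \o rho) (obj_map e \o z) = obj_map e (value rho z).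
Proof. by case: t z. Qed.

Lemma sat_unravel (X : Type) (rho : X -> obj tau Y) (t : term S X)
    (z : nodes t -> obj tau Y) :
  sat (unravel rho z) e <->
  sat (M := M) (unravel (obj_map e \o rho) (obj_map e \o z)) id.
Proof.
elim: t z => [x|f ts IH] z //.
rewrite [unravel rho z]/= [unravel (_ \o _) _]/= !sat_And !sat_bigAnd.
rewrite sat_fun_at (_ : (fun k => obj_map e _) = fun k =>
  value (obj_map e \o rho) (fun n => obj_map e (z (Some (existT _ k n))))).
  by split=> -[us fz]; split=> // k; apply/IH/us.
by apply: funext => k; rewrite -value_obj_map.
Qed.

End Environment.

(* [Y'] is [Y] extended by the variables for the objects, and [g] the
   inclusion; [P] is the meaning of [body] at objects over [M]. *)
Lemma sat_ex_objs (Y : Type) (e : Y -> M) (N : finType)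
    (body : forall Y' : Type, (Y -> Y') -> (N -> obj tau Y') -> form T Y')
    (P : (N -> obj tau M) -> Prop) :
  (forall Y' (g : Y -> Y') z (e' : Y' -> M), e' \o g = e ->
     sat (body Y' g z) e' <-> P (obj_map e' \o z)) ->
  sat (ex_objs body) e <-> exists z : N -> translated, P (fun n => sval (z n)).
Proof.
move=> bodyP; rewrite sat_bigOr; split=> [[p]|[z Pz]].
  rewrite sat_ex_block => -[w]; rewrite sat_And sat_bigAnd => -[dz].
  rewrite bodyP // => Pz.
  by exists (fun n => translated_obj (iffLR (sat_dom_at _ _) (dz n))); exact: Pz.
pose p := [ffun n => tag (sval (z n))].
(* The finite function [p] reduces only by a proved equation, so the coordinates of [z n] are chosen
   as a tuple over [p n] instead of being transported. *)
have w n : {v : 'I_(dim (p n)) -> M | existT _ (p n) v = sval (z n)}.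
  by apply: cid; rewrite ffunE; exists (tagged (sval (z n))); case: (sval _).
have E : obj_map (sum_env e (fun nk => sval (w (tag nk)) (tagged nk))) \o
    (fun n => existT _ (p n) (fun k => inr (existT _ n k)) : obj tau _) =
    fun n => sval (z n).
  by apply: funext => n; rewrite -(svalP (w n)).
exists p; rewrite sat_ex_block.
exists (fun nk => sval (w (tag nk)) (tagged nk)); rewrite sat_And sat_bigAnd.
split=> [n|]; last by rewrite bodyP // E.
rewrite sat_dom_at; have /= -> := congr1 (fun h => h n) E; exact: svalP (z n).
Qed.

Lemma value_translated X (rho : X -> translated) (t : term S X)
    (z : nodes t -> translated) :
  exists y : translated,
    sval y = value (fun x => sval (rho x)) (fun n => sval (z n)).
Proof. by case: t z => [x|f ts] z; [exists (rho x) | exists (z None)]. Qed.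

(** A value arises by labelling each occurrence of a function symbol with an object; the unravelled
    formula says that the labels respect the graphs. *)
Lemma has_value_translated X (rho : X -> translated) (t : term S X) y :
  has_value t rho y <-> exists z : nodes t -> translated,
    sat (M := M) (unravel (fun x => sval (rho x)) (fun n => sval (z n))) id /\
    sval y = value (fun x => sval (rho x)) (fun n => sval (z n)).
Proof.
elim: t y => [x|f ts IH] y /=.
  split=> [->|[z [_ /sval_translated_inj]]//].
  by exists (fun v : void => match v with end).
split=> [[ys vs fy]|[z [/sat_And[/sat_bigAnd us fz] yz]]].
  have zs k := cid (iffLR (IH k (ys k)) (vs k)).
  (* The root is labelled with [y], the nodes of each argument as the induction hypothesis gives. *)
  exists (fun o => if o is Some (existT k n) then sval (zs k) n else y).
  split=> //; apply/sat_And; rewrite sat_bigAnd; split=> [k|].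
    by have [] := svalP (zs k).
  move: fy; congr (sat (M := M) (fun_at _ _)); apply: funext => k /=.
  by have [] := svalP (zs k).
have /choice[ys ysz] :=
  fun k => value_translated rho (fun n => z (Some (existT _ k n))).
exists ys => [k|].
  by apply/IH; exists (fun n => z (Some (existT _ k n))); split=> //; apply: us.
move: fz; rewrite yz; congr (sat (M := M) (fun_at _ _)); apply: funext => k.
by rewrite /= ysz.
Qed.

(** The clauses of [translate] imitate those of [sat]. The type of [rho'] ensures that the objects
    put for variables lie in the domain. *)
Lemma sat_translate X (a : form S X) (Y : Type) (rho : X -> obj tau Y)
    (e : Y -> M) (rho' : X -> translated) :
  (forall x, sval (rho' x) = obj_map e (rho x)) ->
  sat (translate a rho) e <-> sat a rho'.
Proof.
elim: a Y rho e rho' => {X} [X|X s t|X r ts|X a IHa b IHb|X a IH] Y rho e rho' E.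
- by [].
(* The variables added by [ex_objs] leave the objects assigned by [rho] unchanged. *)
- have env Y' (g : Y -> Y') (e' : Y' -> M) : e' \o g = e ->
      obj_map e' \o (obj_map g \o rho) = fun x => sval (rho' x).
    by move=> ge; apply: funext => x; rewrite E -ge.
  rewrite /= (sat_ex_objs (P := fun z : _ -> obj tau M =>
    let rho0 x := sval (rho' x) in
    (sat (M := M) (unravel rho0 (z \o inl)) id /\
     sat (M := M) (unravel rho0 (z \o inr)) id) /\
    sat (M := M) (eq_at (value rho0 (z \o inl)) (value rho0 (z \o inr))) id));
    last first.
    move=> Y' g z e' /env ge; rewrite !sat_And !(sat_unravel e') sat_eq_at.
    by rewrite -!value_obj_map ge.
  split=> [[z [[us ut] st]]|[u [v [/has_value_translated[y [us uy]]
      /has_value_translated[z [ut vz]] uv]]]].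
    have [u uE] := value_translated rho' (z \o inl).
    have [v vE] := value_translated rho' (z \o inr).
    exists u, v; split.
    + by apply/has_value_translated; exists (z \o inl).
    + by apply/has_value_translated; exists (z \o inr).
    + by rewrite /= uE vE.
  exists (fun n => match n with inl m => y m | inr m => z m end).
  by split; [split | rewrite -[value _ _]uy -[X in eq_at _ X]vz].
- have env Y' (g : Y -> Y') (e' : Y' -> M) : e' \o g = e ->
      obj_map e' \o (obj_map g \o rho) = fun x => sval (rho' x).
    by move=> ge; apply: funext => x; rewrite E -ge.
  rewrite /= (sat_ex_objs (P := fun z : _ -> obj tau M =>
    let rho0 x := sval (rho' x) in
    let zs k (n : nodes (ts k)) := z (existT _ k n) in
    (forall k, sat (M := M) (unravel rho0 (zs k)) id) /\
    sat (M := M) (rel_at (fun k => value rho0 (zs k))) id)); last first.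
    move=> Y' g z e' /env ge; rewrite !sat_And sat_bigAnd sat_rel_at.
    rewrite (_ : (fun k => obj_map e' _) = fun k =>
      value (fun x => sval (rho' x)) (fun n => obj_map e' (z (existT _ k n)))).
      by split=> -[us rz]; split=> // k; move: (us k); rewrite (sat_unravel e') ge.
    by apply: funext => k; rewrite -value_obj_map ge.
  split=> [[z [us rz]]|[ys vs ry]].
    have /choice[ys ysz] :=
      fun k => value_translated rho' (fun n => z (existT _ k n)).
    exists ys => [k|].
      apply/has_value_translated; exists (fun n => z (existT _ k n)).
      by split=> //; apply: us.
    move: rz; congr (sat (M := M) (rel_at _)); apply: funext => k.
    by rewrite /= ysz.
  have zs k := cid (iffLR (has_value_translated _ _ _) (vs k)).
  exists (fun o => let: existT k n := o in sval (zs k) n); split=> [k|].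
    by have [] := svalP (zs k).
  move: ry; congr (sat (M := M) (rel_at _)); apply: funext => k /=.
  by have [] := svalP (zs k).
- by rewrite /= (IHa _ _ _ _ E) (IHb _ _ _ _ E).
(* An element is a piece, a tuple and a proof of membership in the domain, matching the conjunction,
   the block and the antecedent. *)
- rewrite /= sat_bigAnd; split=> [H [[i w] d]|H i].
    have := H i; rewrite sat_all_block => /(_ w) /= H'.
    apply/(IH _ _ (sum_env e w)); last by apply: H'; rewrite sat_dom_at.
    by case=> [x|] //=; rewrite E.
  rewrite sat_all_block => w /= /sat_dom_at d.
  apply/(IH _ _ _ (extend rho' (translated_obj d))); last exact: H.
  by case=> [x|] //=; rewrite E.
Qed.

Lemma models_translate_sentence a :
  models M (translate_sentence tau a) <-> models translated a.
Proof. by apply: sat_translate => -[]. Qed.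

End Translation.

(** * Finite parts of an interpretation *)

Section Normality.
Variable S : signature.

Definition univ_closure (I : finType) (a : form S I) : sentence S :=
  all_block (I := I) (rename inr a).

Lemma models_univ_closure (M : structure S) (I : finType) (a : form S I) :
  models M (univ_closure a) <-> forall w : I -> M, sat a w.
Proof.
by rewrite /models sat_all_block; split=> H w; have := H w; rewrite sat_rename.
Qed.

Lemma sat_Eq_Var (M : structure S) (X : Type) x y (w : X -> M) :
  sat (Eq (Var x) (Var y)) w <-> eqv (w x) (w y).
Proof.
by split=> [[u [v [/= -> ->]]]//|xy]; exists (w x), (w y).
Qed.

Lemma sat_Eq_App (M : structure S) (X : Type) (f : fsym S) xs y (w : X -> M) :
  sat (Eq (App (f := f) (fun k => Var (xs k))) (Var y)) w <->
  exists2 v, graph (fun k => w (xs k)) v & eqv v (w y).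
Proof.
split=> [[u [v [[us usE fu] /= -> uy]]]|[v fv vy]].
  by exists u => //; rewrite (_ : (fun k => _) = us) //; apply: funext.
by exists v, (w y); split=> //; exists (fun k => w (xs k)).
Qed.

Lemma sat_Rel_Var (M : structure S) (X : Type) (r : rsym S) xs (w : X -> M) :
  sat (Rel (r := r) (fun k => Var (xs k))) w <-> holds (fun k => w (xs k)).
Proof.
split=> [[us usE]|h]; last by exists (fun k => w (xs k)).
by rewrite (_ : us = fun k => w (xs k)) //; apply: funext.
Qed.

Definition nonempty_axiom : sentence S := Ex (Eq (Var None) (Var None)).

Definition refl_axiom : sentence S :=
  univ_closure (I := unit) (Eq (Var tt) (Var tt)).

Definition sym_axiom : sentence S :=
  univ_closure (I := bool)
    (Imp (Eq (Var false) (Var true)) (Eq (Var true) (Var false))).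

Definition trans_axiom : sentence S :=
  univ_closure (I := option bool)
    (Imp (Eq (Var (Some false)) (Var None))
      (Imp (Eq (Var None) (Var (Some true)))
        (Eq (Var (Some false)) (Var (Some true))))).

Definition total_axiom (f : fsym S) : sentence S :=
  univ_closure (I := 'I_(far f))
    (Ex (Eq (App (fun k => Var (Some k))) (Var None))).

Definition graph_axiom (f : fsym S) : sentence S :=
  univ_closure (I := (bool + bool * 'I_(far f))%type)
    (Imp (\big[@And S _/Top]_k Eq (Var (inr (false, k))) (Var (inr (true, k))))
      (Imp (Eq (App (fun k => Var (inr (false, k)))) (Var (inl false)))
        (Imp (Eq (App (fun k => Var (inr (true, k)))) (Var (inl true)))
          (Eq (Var (inl false)) (Var (inl true)))))).

Definition holds_axiom (r : rsym S) : sentence S :=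
  univ_closure (I := (bool * 'I_(rar r))%type)
    (Imp (\big[@And S _/Top]_k Eq (Var (false, k)) (Var (true, k)))
      (Imp (Rel (fun k => Var (false, k))) (Rel (fun k => Var (true, k))))).

(** Valid in every normal structure, hence provable in every theory; it has content only for
    structures such as [translated], whose [eqv] and graphs are arbitrary. *)
Definition normality : sentence S :=
  And nonempty_axiom (And (And refl_axiom (And sym_axiom trans_axiom))
    (And (\big[@And S _/Top]_f And (total_axiom f) (graph_axiom f))
      (\big[@And S _/Top]_r holds_axiom r))).

Lemma models_normality (M : structure S) : models M normality <-> normal M.
Proof.
(* Without reflexivity the axiom yields a value together with something it is identified with; the
   surplus disappears once reflexivity is available. *)
have totalP f : models M (total_axiom f) <->
    forall us : _ -> M, exists2 v, graph (f := f) us v & exists u, eqv v u.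
  rewrite models_univ_closure; split=> H us.
    by have /sat_Ex[u /sat_Eq_App[v fv vu]] := H us; exists v => //; exists u.
  have [v fv [u vu]] := H us; apply/sat_Ex; exists u; apply/sat_Eq_App.
  by exists v.
have normalityP : models M normality <->
    [/\ exists d : M, eqv d d,
        [/\ models M refl_axiom, models M sym_axiom & models M trans_axiom],
        forall f, models M (total_axiom f) /\ models M (graph_axiom f) &
        forall r, models M (holds_axiom r)].
  rewrite /normality {1}/models !sat_And !sat_bigAnd.
  split=> [[/sat_Ex[d /sat_Eq_Var dd] [[rM [sM tM]] [fM hM]]]|].
    by split=> //; [exists d | move=> f; apply/sat_And/fM].
  move=> [[d dd] [rM sM tM] fM hM]; split.
    by apply/sat_Ex; exists d; apply/sat_Eq_Var.
  by do !split=> //; move=> f; apply/sat_And/fM.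
rewrite normalityP; split.
  case=> -[d _] [/models_univ_closure rM /models_univ_closure sM
    /models_univ_closure tM] fM hM.
  have rM' (u : M) : eqv u u by have /sat_Eq_Var := rM (fun=> u).
  split=> //.
  - move=> u v uv.
    pose w (b : bool) := if b then v else u.
    by apply/(sat_Eq_Var true false w)/(sM w)/sat_Eq_Var.
  - move=> u v w uv vw.
    pose e o := if o is Some b then if b then w else u else v.
    by apply/(sat_Eq_Var (Some false) (Some true) e)/(tM e); apply/sat_Eq_Var.
  - move=> f us; have [/totalP H _] := fM f.
    by have [v fv _] := H us; exists v.
  - move=> f us vs u v E fu fv.
    have [_ /models_univ_closure H] := fM f.
    apply/(sat_Eq_Var (inl false) (inl true) (fun x : bool + bool * 'I_(far f) =>
      match x with
      | inl b => if b then v else u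
      | inr (b, k) => if b then vs k else us k
      end))/H.
    + by apply/sat_bigAnd => k; apply/sat_Eq_Var/E.
    + by apply/sat_Eq_App; exists u.
    + by apply/sat_Eq_App; exists v.
  - move=> r us vs E hu; have /models_univ_closure H := hM r.
    apply/(sat_Rel_Var (fun k => (true, k)) (fun x : bool * 'I_(rar r) =>
      if x.1 then vs x.2 else us x.2))/H.
    + by apply/sat_bigAnd => k; apply/sat_Eq_Var/E.
    + exact/sat_Rel_Var.
move=> [[d _] rM sM tM fM gM hM]; split.
- by exists d; apply: rM.
- split; apply/models_univ_closure => w.
  + exact/sat_Eq_Var/rM.
  + by move=> /sat_Eq_Var uv; apply/sat_Eq_Var/sM.
  + by move=> /sat_Eq_Var uv /sat_Eq_Var vw; apply/sat_Eq_Var/(tM _ _ _ uv vw).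
- move=> f; split.
    apply/totalP => us; have [v fv] := fM f us; exists v => //.
    by exists v; apply: rM.
  apply/models_univ_closure => w /sat_bigAnd E /sat_Eq_App[u fu uw].
  move=> /sat_Eq_App[v fv vw]; apply/sat_Eq_Var.
  (* The values in the graphs match the variables only up to [eqv], so symmetry and transitivity
     have to link them. *)
  apply: (tM _ _ _ (sM _ _ uw)); apply: (tM _ _ _ _ vw); apply: gM fu fv => k.
  exact/sat_Eq_Var/E.
- move=> r; apply/models_univ_closure => w /sat_bigAnd E /sat_Rel_Var hu.
  apply/sat_Rel_Var; apply: hM hu => k; exact/sat_Eq_Var/E.
Qed.

Definition conjunction (L : seq (sentence S)) : sentence S :=
  foldr (@And S void) Top L.

Lemma models_conj (M : structure S) L :
  models M (conjunction L) <-> forall a, List.In a L -> models M a.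
Proof.
elim: L => [|a L IH]; first by split=> [_ ? []|_ []].
rewrite /models sat_And; split=> [[aM /IH LM] b [<-//|/LM//]|LM].
by split; [apply: LM; left | apply/IH => b bL; apply: LM; right].
Qed.

Lemma prf_models (G : theory S) a (M : structure S) :
  prf G a -> normal M -> (forall b, G b -> models M b) -> models M a.
Proof. by move=> p nM; apply: soundness nM p. Qed.

(** Proved through models: soundness and completeness replace a manipulation of derivations. *)
Lemma prf_cut (G H : theory S) a :
  prf G a -> (forall b, G b -> prf H b) -> prf H a.
Proof.
move=> p GH; apply: completeness => M nM HM; apply: (prf_models p nM) => b Gb.
exact: prf_models (GH _ Gb) nM HM.
Qed.

Lemma prf_add_axiom (G H : theory S) c a :
  (forall b, prf G b -> prf H b) -> prf H c ->
  prf (add_axiom G c) a -> prf H a.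
Proof.
by move=> GH Hc p; apply: prf_cut p _ => b [/prf_ax/GH|->].
Qed.

(** The conjunction of the finitely many axioms used serves as [c]; it entails [a] by itself, so the
    base theory [U] is arbitrary. *)
Lemma prf_compact_sentence (G : theory S) a : prf G a ->
  exists2 c, prf G c & forall U : theory S, prf (add_axiom U c) a.
Proof.
move=> /prf_compact[L LG p]; exists (conjunction L) => [|U].
  by apply: completeness => M _ GM; apply/models_conj => b /LG/GM.
apply: completeness => M nM UM; apply: (prf_models p nM).
by apply/models_conj/UM; right.
Qed.

End Normality.

(* Whether the translated structure of a model is a model of [A] is expressed
   by the translation of the single sentence [conjunction (normality :: A)], for
   whose provability finitely many axioms suffice. *)
Lemma interprets_compact (T : signature) (W : theory T) (A : fin_theory) :
  interprets W (theory_of A) ->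
  exists2 c, prf W c &
    forall U : theory T, interprets (add_axiom U c) (theory_of A).
Proof.
move=> [tau tauA]; pose chi := conjunction (normality _ :: fin_axioms A).
have : prf (theory_of A) chi.
  apply: completeness => M nM AM; apply/models_conj => a [<-|/AM //].
  exact/models_normality.
move=> /tauA/prf_compact_sentence[c Wc cchi]; exists c => // U.
exists tau => a Aa; apply: completeness => M nM UM.
(* Hence the structure translated from [M] is normal and satisfies the axioms of [A], so soundness
   applies in it to every theorem of [A]. *)
have /models_translate_sentence/models_conj chiM := prf_models (cchi U) nM UM.
apply/models_translate_sentence; apply: (prf_models Aa) => [|b Ab].
  by apply/models_normality/chiM; left.
by apply: chiM; right.
Qed.

(** * Transfer of interpreters to extensions *)

Lemma interprets_extends (T S : signature) (G H : theory T) (D : theory S) :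
  extends H G -> interprets G D -> interprets H D.
Proof. by move=> HG [tau tauD]; exists tau => a /tauD/HG. Qed.

(** The property of [C] over [U] is applied to a theorem [c] of [V + B] in place of [B]. *)
Lemma interpreter_extends (S : signature) (U V : theory S) A C :
  extends V U -> interpreter U A C -> interpreter V A C.
Proof.
move=> UV UC B.
have UVB c : prf (add_axiom V B) c -> extends (add_axiom V B) (add_axiom U c).
  move=> Vc a; apply: prf_add_axiom Vc => b /UV p.
  by apply: prf_weaken p _; left.
split=> [/interprets_compact[c Vc Uc]|/prf_compact_sentence[c Vc Uc]].
- by apply: (UVB c Vc); apply/UC/Uc.
- by apply: interprets_extends (UVB c Vc) _; apply/UC/Uc.
Qed.

Theorem theorem4p1 (S : signature) (U V : theory S) (UV : extends V U) :
  (Friedman_reflexive U -> Friedman_reflexive V) /\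
  (effectively_Friedman_reflexive U -> effectively_Friedman_reflexive V) /\
  (forall C : fin_theory -> sentence S,
     selects_interpreters U C -> selects_interpreters V C).
Proof.
have sel C : selects_interpreters U C -> selects_interpreters V C.
  by move=> UC A; apply: interpreter_extends UV (UC A).
split; last split=> //.
- by move=> UF A; have [C /(interpreter_extends UV)] := UF A; exists C.
(* The selecting function is kept, so it remains recursive. *)
- by move=> [C [rC UC]]; exists C; split=> //; apply: sel.
Qed.
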